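(* Let $p$ be a prime, let $(\mathbf{g},\mathbf{h},\mathbf{n})$ be an orthogonal basis of $\mathbb{Q}_p^3$ (with respect to $Q_+$) and $\alpha=Q_+(\mathbf{h})/Q_+(\mathbf{g})$. Then every $L\in SO(3)_p$ with $L\mathbf{n}=\mathbf{n}$ has, with respect to the basis $(\mathbf{g},\mathbf{h},\mathbf{n})$, the matrix $$\mathcal{R}_{\mathbf{n}}(\sigma)=\begin{pmatrix}\frac{1-\alpha\sigma^2}{1+\alpha\sigma^2} & -\frac{2\alpha\sigma}{1+\alpha\sigma^2} & 0\\ \frac{2\sigma}{1+\alpha\sigma^2} & \frac{1-\alpha\sigma^2}{1+\alpha\sigma^2} & 0\\ 0&0&1\end{pmatrix}$$ for some $\sigma\in\mathbb{Q}_p\cup\{\infty\}$, where $\mathcal{R}_{\mathbf{n}}(\infty)=\mathrm{diag}(-1,-1,1)$.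
   Context: For $p$ odd, fix a unit $u\in\mathbb{Z}_p^\times$ that is not a square in $\mathbb{Q}_p$, and set $v=-u$ if $p\equiv 1 \pmod 4$, $v=-1$ if $p\equiv 3\pmod 4$. Define $Q_+(\mathbf{x})=x_1^2-vx_2^2+px_3^2$ for $p$ odd and $Q_+(\mathbf{x})=x_1^2+x_2^2+x_3^2$ for $p=2$, with diagonal matrix $A$ and bilinear form $b(\mathbf{x},\mathbf{y})=\mathbf{x}^\top A\mathbf{y}$; a basis is orthogonal if its vectors are pairwise $b$-orthogonal. $SO(3)_p=\{L\in M_{3\times 3}(\mathbb{Q}_p): L^\top A L=A,\ \det L=1\}$. (One has $1+\alpha\sigma^2\neq 0$ for all $\sigma\in\mathbb{Q}_p$.) *)

(* Defs.v *)
From HB Require Import structures.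
From mathcomp Require Import all_boot all_order all_algebra.
From mathcomp Require Import boolp.

Set Implicit Arguments.
Unset Strict Implicit.
Unset Printing Implicit Defensive.

Import GRing.Theory.
Local Open Scope ring_scope.

(** [Z_p] is the inverse limit of the rings Z / p^n: an element is the sequence
    of its canonical representatives modulo p^n. The coherence condition forces
    [pint_res x n < p ^ n], so that equality is Leibniz equality. [Q_p] is the
    fraction field of [Z_p]. *)

Record padic_int (p : nat) (p_pr : prime p) : Type := PadicInt {
  pint_res :> nat -> nat;
  pint_coherent : forall n, pint_res n = (pint_res n.+1 %% p ^ n)%N
}.

Section PadicInt.
Variables (p : nat) (p_pr : prime p).
Notation Zp := (padic_int p_pr).

HB.instance Definition _ := gen_eqMixin Zp.
HB.instance Definition _ := gen_choiceMixin Zp.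

Lemma pint_eq (x y : Zp) : (forall n, x n = y n) -> x = y.
Proof.
case: x y => [x hx] [y hy] /= exy.
have exy' : x = y by apply: funext.
by subst y; congr PadicInt; apply: Prop_irrelevance.
Qed.

Lemma pint_modS n m : (m %% p ^ n.+1 %% p ^ n = m %% p ^ n)%N.
Proof. by apply: modn_dvdm; apply: dvdn_exp2l. Qed.

Lemma pint_modE (x : Zp) n : (x n %% p ^ n)%N = x n.
Proof. by rewrite pint_coherent modn_mod. Qed.

Lemma pint_le_mod (x : Zp) n m : (n <= m)%N -> (x m %% p ^ n)%N = x n.
Proof.
move/subnK <-; elim: (m - n)%N => [|k IHk]; first exact: pint_modE.
rewrite -{}IHk [in RHS]pint_coherent addSn modn_dvdm //.
by apply: dvdn_exp2l; apply: leq_addl.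
Qed.

Lemma pint_of_subproof (f : nat -> nat) :
    (forall n, f n = f n.+1 %[mod p ^ n])%N ->
  forall n, (f n %% p ^ n = f n.+1 %% p ^ n.+1 %% p ^ n)%N.
Proof. by move=> hf n; rewrite pint_modS. Qed.

Definition pint_of f hf : Zp :=
  PadicInt p_pr (@pint_of_subproof f hf).

Lemma pint_coherentm (x : Zp) n : (x n = x n.+1 %[mod p ^ n])%N.
Proof. by rewrite -pint_coherent pint_modE. Qed.

Lemma pint0_subproof n : (0 = 0 %[mod p ^ n])%N. Proof. by []. Qed.
Lemma pint1_subproof n : (1 = 1 %[mod p ^ n])%N. Proof. by []. Qed.

Lemma pint_add_subproof (x y : Zp) n :
  (x n + y n = x n.+1 + y n.+1 %[mod p ^ n])%N.
Proof. by rewrite -modnDm !(pint_coherentm _ n) modnDm. Qed.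

Lemma pint_mul_subproof (x y : Zp) n :
  (x n * y n = x n.+1 * y n.+1 %[mod p ^ n])%N.
Proof. by rewrite -modnMm !(pint_coherentm _ n) modnMm. Qed.

Lemma pint_lt (x : Zp) n : (x n < p ^ n)%N.
Proof. by rewrite -pint_modE ltn_pmod // expn_gt0 prime_gt0. Qed.

Lemma pint_opp_subproof (x : Zp) n :
  (p ^ n - x n = p ^ n.+1 - x n.+1 %[mod p ^ n])%N.
Proof.
apply/eqP; rewrite -(eqn_modDr (x n.+1)) subnK; last exact: ltnW (pint_lt _ _).
rewrite -modnDmr -pint_coherent subnK; last exact: ltnW (pint_lt _ _).
by rewrite modnn eq_sym; apply: dvdn_exp2l.
Qed.

Definition pint0 : Zp := pint_of pint0_subproof.
Definition pint1 : Zp := pint_of pint1_subproof.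
Definition pint_add (x y : Zp) : Zp := pint_of (pint_add_subproof x y).
Definition pint_mul (x y : Zp) : Zp := pint_of (pint_mul_subproof x y).
Definition pint_opp (x : Zp) : Zp := pint_of (pint_opp_subproof x).

Lemma pint_addA : associative pint_add.
Proof. by move=> x y z; apply: pint_eq => n /=; rewrite modnDmr modnDml addnA. Qed.
Lemma pint_addC : commutative pint_add.
Proof. by move=> x y; apply: pint_eq => n /=; rewrite addnC. Qed.
Lemma pint_add0 : left_id pint0 pint_add.
Proof. by move=> x; apply: pint_eq => n /=; rewrite mod0n pint_modE. Qed.
Lemma pint_addN : left_inverse pint0 pint_opp pint_add.
Proof.
move=> x; apply: pint_eq => n /=; rewrite modnDml subnK ?modnn ?mod0n //.
exact: ltnW (pint_lt _ _).
Qed.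

HB.instance Definition _ :=
  GRing.isZmodule.Build Zp pint_addA pint_addC pint_add0 pint_addN.

Lemma pint_mulA : associative pint_mul.
Proof. by move=> x y z; apply: pint_eq => n /=; rewrite modnMmr modnMml mulnA. Qed.
Lemma pint_mulC : commutative pint_mul.
Proof. by move=> x y; apply: pint_eq => n /=; rewrite mulnC. Qed.
Lemma pint_mul1 : left_id pint1 pint_mul.
Proof.
by move=> x; apply: pint_eq => n /=; rewrite modnMml mul1n pint_modE.
Qed.
Lemma pint_mulDl : left_distributive pint_mul pint_add.
Proof.
by move=> x y z; apply: pint_eq => n /=; rewrite modnMml modnDm mulnDl.
Qed.
Lemma pint_1neq0 : pint1 != 0 :> Zp.
Proof.
apply/eqP => /(congr1 (fun x : Zp => x 1%N)) /=.
by rewrite mod0n modn_small // expn1 prime_gt1.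
Qed.

HB.instance Definition _ :=
  GRing.Zmodule_isComNzRing.Build Zp
    pint_mulA pint_mulC pint_mul1 pint_mulDl pint_1neq0.

Definition pint_unit : {pred Zp} := fun x => `[< exists y : Zp, y * x = 1 >].

Definition pint_inv (x : Zp) : Zp :=
  if pselect (exists y : Zp, y * x = 1) is left h then projT1 (cid h) else x.

Lemma pint_mulV : {in pint_unit, left_inverse 1 pint_inv *%R}.
Proof.
by move=> x /asboolP hx; rewrite /pint_inv; case: pselect => // h; case: (cid h).
Qed.
Lemma pint_unitP (x y : Zp) : y * x = 1 -> pint_unit x.
Proof. by move=> e; apply/asboolP; exists y. Qed.
Lemma pint_inv_out : {in [predC pint_unit], pint_inv =1 id}.
Proof.
by move=> x /negP hx; rewrite /pint_inv; case: pselect => // h; case: hx; apply/asboolP.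
Qed.

HB.instance Definition _ :=
  GRing.ComNzRing_hasMulInverse.Build Zp pint_mulV pint_unitP pint_inv_out.

Lemma pint_neq0 (x : Zp) : x <> 0 ->
  exists n, forall m, (n <= m)%N -> ~~ (p ^ n %| x m)%N.
Proof.
move=> x0; apply: contrapT => h; apply: x0; apply: pint_eq => n /=.
rewrite mod0n; apply/eqP/negPn/negP => xn; apply: h; exists n => m nm.
by rewrite /dvdn pint_le_mod.
Qed.

Lemma pint_mul_eq0 : GRing.integral_domain_axiom Zp.
Proof.
move=> x y xy0; apply/orP; have [?|/pint_neq0[n hn]] := pselect (x = 0).
  by left; apply/eqP.
have [?|/pint_neq0[m hm]] := pselect (y = 0); first by right; apply/eqP.
have /= := congr1 (fun z : Zp => z (n + m)%N) xy0; rewrite mod0n => /eqP.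
have {hn} := hn _ (leq_addr m n); have {hm} := hm _ (leq_addl n m).
set a := x _; set b := y _ => hb ha hab; exfalso.
have a0 : (0 < a)%N by case: (a) ha => //; rewrite dvdn0.
have b0 : (0 < b)%N by case: (b) hb => //; rewrite dvdn0.
move: ha hb hab; rewrite -/(_ %| _)%N !pfactor_dvdn ?muln_gt0 ?a0 //.
rewrite lognM // -!ltnNge => lt1 lt2 le.
by have := leq_add lt1 lt2; rewrite addSn addnS ltnNge ltnW // ltnNge le.
Qed.

HB.instance Definition _ :=
  GRing.ComUnitRing_isIntegral.Build Zp pint_mul_eq0.

Definition padic : Type := {fraction Zp}.
HB.instance Definition _ := GRing.Field.on padic.

Definition padic_of_int (x : Zp) : padic := FracField.tofrac x.

End PadicInt.

Section QPlus.
Variables (p : nat) (p_pr : prime p).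
Notation Zp := (padic_int p_pr).
Notation Qp := (padic p_pr).

Definition nonsquare_unit (u : Zp) : Prop :=
  u \is a GRing.unit /\ ~ exists y : Qp, y ^+ 2 = padic_of_int u.

Variable u : Zp.

Definition v_coef : Qp := if (p %% 4 == 1)%N then - padic_of_int u else -1.

(* [x i 0] with [i] = 0, 1, 2 is the mathematical x_{i+1}. When [p] is even,
   i.e. [p = 2], the parameter [u] is not used. *)
Definition Qplus (x : 'cV[Qp]_3) : Qp :=
  if odd p then
    x 0 0 ^+ 2 - v_coef * x 1 0 ^+ 2 + p%:R * x (inord 2) 0 ^+ 2
  else x 0 0 ^+ 2 + x 1 0 ^+ 2 + x (inord 2) 0 ^+ 2.

Definition Aplus : 'M[Qp]_3 :=
  diag_mx (\row_(i < 3)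
    (if odd p then [:: 1; - v_coef; p%:R] else [:: 1; 1; 1])`_i).

Definition bplus (x y : 'cV[Qp]_3) : Qp := (x^T *m Aplus *m y) 0 0.

Lemma Qplus_bplus x : Qplus x = bplus x x.
Proof.
rewrite /bplus -mulmxA mul_diag_mx mxE !big_ord_recl big_ord0 !mxE /Qplus.
have -> : lift ord0 (lift ord0 ord0) = inord 2 :> 'I_3.
  by apply: val_inj; rewrite /= inordK.
have -> : lift ord0 ord0 = 1 :> 'I_3 by apply: val_inj.
rewrite inordK //=; case: ifP => _ /=;
by rewrite !mul1r !expr2 ?addr0 ?mulNr ?mulrN -?addrA;
   do ?[congr (_ + _)]; rewrite mulrCA.
Qed.

(* As [bplus] is symmetric, orthogonality is only required for ordered pairs. *)
Definition orthogonal_basis (e : 3.-tuple 'cV[Qp]_3) : Prop :=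
  basis_of fullv e /\ pairwise (fun x y => bplus x y == 0) e.

Definition SO3 (L : 'M[Qp]_3) : Prop :=
  L^T *m Aplus *m L = Aplus /\ \det L = 1.

End QPlus.

Section Rotations.
Variable F : fieldType.

(* Matrices act on column vectors: column [j] holds the coordinates of the
   image of the [j]-th basis vector. *)
Definition mx_in_basis n (e : n.-tuple 'cV[F]_n) (L : 'M[F]_n) : 'M[F]_n :=
  \matrix_(i, j) coord e i (L *m e`_j).

Definition mx_of_rows n (rows : seq (seq F)) : 'M[F]_n :=
  \matrix_(i, j) (nth [::] rows i)`_j.

(* [None] is the point at infinity of the projective line over [F]. *)
Definition rotation_mx (alpha : F) (s : option F) : 'M[F]_3 :=
  if s is Some sigma then
    let d := 1 + alpha * sigma ^+ 2 in
    mx_of_rows 3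
      [:: [:: (1 - alpha * sigma ^+ 2) / d; - (2 * alpha * sigma / d); 0];
          [:: 2 * sigma / d; (1 - alpha * sigma ^+ 2) / d; 0];
          [:: 0; 0; 1]]
  else
    mx_of_rows 3
      [:: [:: -1; 0; 0];
          [:: 0; -1; 0];
          [:: 0; 0; 1]].

End Rotations.

(* Main.v *)
(** In the basis (g, h, n) the isometry L becomes a matrix M of determinant 1
    preserving D = diag(Q g, Q h, Q n), which is invertible because the form is
    nondegenerate. As M fixes the third basis vector and preserves D, it is
    block diagonal, and its upper left block has the form
    (a, - alpha * c; c, a) with a ^ 2 + alpha * c ^ 2 = 1. Stereographic
    projection from (-1, 0), i.e. sigma = c / (1 + a), parametrises this conic;
    the base point itself is sigma = oo. The denominators do not
    vanish, as 1 + alpha * sigma ^ 2 = 2 / (1 + a). *)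

Require Import Defs.
From mathcomp Require Import all_boot all_order all_algebra.
From mathcomp Require Import ring.

Import GRing.Theory.

Local Open Scope ring_scope.

(** The change-of-basis matrix $P$ from coordinates in [e] to standard coordinates. *)
Definition cols_mx {F : fieldType} {n : nat} (e : n.-tuple 'cV[F]_n) : 'M[F]_n :=
  \matrix_(i, j) e`_j i 0.

Lemma mul_cols_mx {F : fieldType} {n : nat} (e : n.-tuple 'cV[F]_n)
    (x : 'cV[F]_n) :
  cols_mx e *m x = \sum_j x j 0 *: e`_j.
Proof.
apply/colP => i; rewrite summxE mxE; apply: eq_bigr => j _.
by rewrite !mxE mulrC.
Qed.

Lemma col_cols_mx {F : fieldType} {n : nat} (e : n.-tuple 'cV[F]_n) (j : 'I_n) :
  col j (cols_mx e) = e`_j.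
Proof. by apply/colP => i; rewrite !mxE. Qed.

Lemma mulmx_colE {R : pzSemiRingType} {m n k : nat} (A : 'M[R]_(m, n))
    (B : 'M[R]_(n, k)) i j :
  (A *m B) i j = (A *m col j B) i 0.
Proof. by rewrite !mxE; apply: eq_bigr => l _; rewrite mxE. Qed.

Lemma cols_mx_unit {F : fieldType} {n : nat} (e : n.-tuple 'cV[F]_n) :
  basis_of fullv e -> cols_mx e \in unitmx.
Proof.
move=> eB.
(* Column [j] of [B] holds the coordinates in [e] of the standard vector [j], so $PB=1$; for square
   matrices a right inverse suffices. *)
pose B := \matrix_(i, j) coord e i (delta_mx j 0 : 'cV[F]_n).
suff /mulmx1_unit[] : cols_mx e *m B = 1%:M by [].
apply/matrixP => i j.
rewrite mulmx_colE mul_cols_mx.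
under eq_bigr do rewrite !mxE.
by rewrite -(coord_basis eB (memvf _)) !mxE eqxx andbT.
Qed.

(** The similarity $M=P^{-1}LP$ without an inverse: both sides have $L e_j$ as column [j]. *)
Lemma mul_mx_in_basis {F : fieldType} {n : nat} (e : n.-tuple 'cV[F]_n)
    (L : 'M[F]_n) :
  basis_of fullv e -> cols_mx e *m mx_in_basis e L = L *m cols_mx e.
Proof.
move=> eB; apply/matrixP => i j.
rewrite mulmx_colE mul_cols_mx [RHS]mulmx_colE col_cols_mx.
under eq_bigr do rewrite !mxE.
by rewrite -(coord_basis eB (memvf _)).
Qed.

Lemma det_mx_in_basis {F : fieldType} {n : nat} (e : n.-tuple 'cV[F]_n)
    (L : 'M[F]_n) :
  basis_of fullv e -> \det (mx_in_basis e L) = \det L.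
Proof.
move=> eB; have := congr1 determinant (mul_mx_in_basis e L eB).
rewrite !det_mulmx [RHS]mulrC; apply: mulfI.
by rewrite -unitfE -unitmxE cols_mx_unit.
Qed.

(** From $PM=LP$, the left side becomes $P^\top(L^\top A L)P$. *)
Lemma gram_mx_in_basis {F : fieldType} {n : nat} (e : n.-tuple 'cV[F]_n)
    (A L : 'M[F]_n) :
  basis_of fullv e -> L^T *m A *m L = A ->
  let D := (cols_mx e)^T *m A *m cols_mx e in
  (mx_in_basis e L)^T *m D *m mx_in_basis e L = D.
Proof.
move=> eB hL D; rewrite /D.
have hM := mul_mx_in_basis e L eB.
rewrite -[LHS]mulmxA -[X in _ *m X]mulmxA hM !mulmxA -trmx_mul hM trmx_mul.
by rewrite -[X in X *m _ = _]mulmxA -(mulmxA _ A) -!mulmxA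
  (mulmxA A) (mulmxA L^T) (mulmxA L^T) hL.
Qed.

Lemma sum_ord3 {V : nmodType} (f : 'I_3 -> V) : \sum_i f i = f 0 + f 1 + f 2%:R.
Proof.
rewrite !big_ord_recl big_ord0 addr0 addrA.
by congr (f _ + f _ + f _); apply: val_inj.
Qed.

Lemma det_mx3_block {R : comNzRingType} (M : 'M[R]_3) :
  M 0 2%:R = 0 -> M 1 2%:R = 0 ->
  \det M = (M 0 0 * M 1 1 - M 0 1 * M 1 0) * M 2%:R 2%:R.
Proof.
move=> M02 M12.
rewrite (expand_det_col M 2%:R) sum_ord3 M02 M12 !mul0r !add0r mulrC.
congr (_ * _); rewrite /cofactor -signr_odd expr0 mul1r.
rewrite (expand_det_row _ 0) !big_ord_recl big_ord0 !mxE.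
rewrite /cofactor !det_mx11 !mxE /=.
rewrite addn0 expr0 mul1r expr1 mulN1r mulrN addr0.
by congr (M _ _ * M _ _ - M _ _ * M _ _); apply: val_inj.
Qed.

Lemma ord3P (P : 'I_3 -> Prop) : P 0 -> P 1 -> P 2%:R -> forall i, P i.
Proof.
move=> P0 P1 P2 [[|[|[|//]]] i3].
- by have -> : Ordinal i3 = 0 by apply: val_inj.
- by have -> : Ordinal i3 = 1 by apply: val_inj.
- by have -> : Ordinal i3 = 2%:R by apply: val_inj.
Qed.

Lemma rotation_mx_diag {F : fieldType} (d : 'rV[F]_3) (M : 'M[F]_3) :
  2%:R != 0 :> F -> (forall i, d 0 i != 0) ->
  M^T *m diag_mx d *m M = diag_mx d -> \det M = 1 ->
  col 2%:R M = delta_mx 2%:R 0 ->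
  exists s, M = rotation_mx (d 0 1 / d 0 0) s.
Proof.
move=> two_neq0 d_neq0 MD detM Mcol.
have ent i j : \sum_k d 0 k * M k i * M k j = diag_mx d i j.
  rewrite -[in RHS]MD -mulmxA mul_diag_mx !mxE; apply: eq_bigr => k _.
  by rewrite !mxE mulrCA mulrA.
have M2 i : M i 2%:R = (i == 2%:R)%:R.
  by move/colP/(_ i): Mcol; rewrite !mxE andbT.
(* Column 2 of [M] is the third unit vector, so its orthogonality to column [j] reads $d_2
   M_{2j}=0$. *)
have Mrow j : j != 2%:R -> M 2%:R j = 0.
  move=> j2; apply: (mulfI (d_neq0 2%:R)); rewrite mulr0.
  have := ent j 2%:R; rewrite mxE (negPf j2) mulr0n sum_ord3 !M2 /= => <-.
  by ring.
have M20 : M 2%:R 0 = 0 by apply: Mrow.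
have M21 : M 2%:R 1 = 0 by apply: Mrow.
move: detM; rewrite det_mx3_block ?M2 //= mulr1.
have := ent 0 0; have := ent 0 1; have := ent 1 1.
rewrite !sum_ord3 M20 M21 !mxE /= !mulr0 !addr0 !mulr1n mulr0n.
set q := d 0 0; set r := d 0 1; have q0 : q != 0 := d_neq0 0.
set a := M 0 0; set b := M 0 1; set c := M 1 0; set e := M 1 1.
move=> E11 E01 E00 E.
(* On the upper block, determinant 1 makes the inverse equal to the adjugate. Comparing entries in
   $DM=M^{-\top}D$ gives $qe=qa$ and $qb=-rc$; the combinations below are this computation with
   [E00], [E01] and [E]. *)
have ea : e = a.
  apply: (mulfI q0); rewrite -[LHS]mulr1.
  have -> : q * e * 1 = (q * a * a + r * c * c) * e - c * (q * a * b + r * c * e).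
    by rewrite E01 E00; ring.
  by rewrite -[RHS]mulr1 -E; ring.
have br : q * b = - (r * c).
  have -> : q * b = (q * a * a + r * c * c) * b by rewrite E00.
  have -> : - (r * c) = a * 0 - r * c * 1 by ring.
  by rewrite -E01 -E; ring.
have bE : b = - (r / q * c) by apply: (mulfI q0); rewrite br; field.
have [a1|a1] := eqVneq (1 + a) 0.
  have aE : a = -1 by apply/eqP; rewrite -addr_eq0 addrC a1.
  have c0 : c = 0.
    apply/eqP; rewrite -sqrf_eq0; apply/eqP/(mulfI (d_neq0 1)).
    rewrite mulr0 -/r; move: E00; rewrite aE => E00.
    by rewrite -[RHS](subrr q) -{1}E00; ring.
  exists None; apply/matrixP; apply: ord3P; apply: ord3P;
    rewrite ?mxE /= ?M2 ?M20 ?M21 // -/a -/b -/c -/e.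
  - by rewrite bE c0 mulr0 oppr0.
  - by rewrite ea.
pose s := c / (1 + a).
have sE : r / q * s ^+ 2 = (1 - a) / (1 + a).
  have -> : r / q * s ^+ 2 = r * c * c / q / (1 + a) ^+ 2.
    by rewrite /s; field; rewrite a1 q0.
  (* The conic relation [E00], with $q(1-a^2)$ factored so that one factor $1+a$ cancels. *)
  have -> : r * c * c = q * (1 - a) * (1 + a).
    by rewrite -[LHS](addKr (q * a * a)) E00; ring.
  by field; rewrite a1 q0.
have denE : 1 + r / q * s ^+ 2 = 2%:R / (1 + a) by rewrite sE; field.
have numE : (1 - r / q * s ^+ 2) / (1 + r / q * s ^+ 2) = a.
  by rewrite denE sE; field; rewrite a1 two_neq0.
have sinE : 2%:R * s / (1 + r / q * s ^+ 2) = c.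
  by rewrite denE /s; field; rewrite a1 two_neq0.
exists (Some s); apply/matrixP; apply: ord3P; apply: ord3P;
  rewrite ?mxE /= ?M2 ?M20 ?M21 // -/a -/b -/c -/e ?numE ?sinE //.
by rewrite bE -[in LHS]sinE; congr (- _); ring.
Qed.

(** Characteristic zero: since $n<p^n$, the residue of $n$ modulo $p^n$ is $n$ itself, hence
    nonzero. It serves for 2 and for the coefficient $p$. *)
Lemma natr_padic_neq0 {p : nat} (p_pr : prime p) (n : nat) :
  (0 < n)%N -> n%:R != 0 :> padic p_pr.
Proof.
move=> n_gt0.
have res k : (n%:R : padic_int p_pr) k = (n %% p ^ k)%N.
  elim: n {n_gt0} => [|n IHn]; first by [].
  by rewrite mulrSr /= IHn modnDm addn1.
have -> : n%:R = padic_of_int (n%:R : padic_int p_pr).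
  by rewrite /padic_of_int rmorph_nat.
rewrite /padic_of_int tofrac_eq0; apply/eqP.
move/(congr1 (fun x : padic_int p_pr => x n)); rewrite res /= mod0n.
have n_lt : (n < p ^ n)%N by apply: ltn_expl; apply: prime_gt1.
by rewrite (modn_small n_lt) => n0; rewrite n0 in n_gt0.
Qed.

Lemma Aplus_unit {p : nat} (p_pr : prime p) (u : padic_int p_pr) :
  (odd p -> nonsquare_unit u) -> Aplus u \in unitmx.
Proof.
move=> hu; rewrite unitmxE det_diag unitfE.
apply/prodf_neq0; apply: ord3P => _; rewrite mxE; case: ifP => p_odd /=;
  rewrite ?oner_eq0 //; last by rewrite natr_padic_neq0 ?prime_gt0.
rewrite oppr_eq0 /v_coef; case: ifP => _; rewrite oppr_eq0 ?oner_eq0 //.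
rewrite /padic_of_int tofrac_eq0.
(* A unit is nonzero. *)
by apply: contraTneq (hu p_odd).1 => ->; rewrite unitr0.
Qed.

Lemma bplusC {p : nat} (p_pr : prime p) (u : padic_int p_pr)
    (x y : 'cV[padic p_pr]_3) :
  bplus u x y = bplus u y x.
Proof.
rewrite /bplus -[in LHS](trmxK (_ *m y)) mxE.
by rewrite !trmx_mul trmxK tr_diag_mx mulmxA.
Qed.

Lemma gram_orthogonal_basis {p : nat} (p_pr : prime p) (u : padic_int p_pr)
    (e : 3.-tuple 'cV[padic p_pr]_3) :
  orthogonal_basis u e ->
  (cols_mx e)^T *m Aplus u *m cols_mx e = diag_mx (\row_i Qplus u e`_i).
Proof.
move=> [_ /(pairwiseP 0) e_orth].
have orth (i j : 'I_3) : (i < j)%N -> bplus u e`_i e`_j = 0.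
  by move=> ij; apply/eqP/e_orth; rewrite // inE size_tuple ltn_ord.
apply/matrixP => i j; rewrite !mxE.
have -> : \sum_k ((cols_mx e)^T *m Aplus u) i k * cols_mx e k j
    = bplus u e`_i e`_j.
  rewrite /bplus -!col_cols_mx tr_col -row_mul mxE.
  by apply: eq_bigr => k _; rewrite !mxE.
have [<-|ij] := eqVneq i j; first by rewrite Qplus_bplus.
(* [orth] covers $i<j$; the case $i>j$ follows by symmetry of the form. *)
rewrite mulr0n; case: (ltngtP i j) => [/orth|/orth|/val_inj/eqP] //.
- by rewrite bplusC.
- by rewrite (negPf ij).
Qed.

Theorem theorem8 (p : nat) (p_pr : prime p) (u : padic_int p_pr)
    (hu : odd p -> nonsquare_unit u)
    (g h n : 'cV[padic p_pr]_3)
    (hB : orthogonal_basis u [tuple g; h; n])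
    (L : 'M[padic p_pr]_3) (hL : SO3 u L) (hLn : L *m n = n) :
  let alpha := Qplus u h / Qplus u g in
  exists s : option (padic p_pr),
    mx_in_basis [tuple g; h; n] L = rotation_mx alpha s.
Proof.
move=> alpha; set e := [tuple g; h; n] in hB *.
have [eB _] := hB; have [LA detL] := hL.
have gramE := gram_orthogonal_basis p_pr u e hB.
pose d : 'rV[padic p_pr]_3 := \row_i Qplus u e`_i.
have -> : alpha = d 0 1 / d 0 0 by rewrite !mxE.
apply: rotation_mx_diag.
- exact: natr_padic_neq0.
(* The Gram matrix $P^\top AP$ is a product of invertible matrices, so the product of the [d 0 i],
   its determinant, is nonzero. *)
- have : diag_mx d \in unitmx.
    by rewrite -gramE !unitmx_mul unitmx_tr cols_mx_unit ?Aplus_unit.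
  rewrite unitmxE det_diag unitfE => /prodf_neq0 d_neq0 i; exact: d_neq0.
- by have := gram_mx_in_basis e _ L eB LA; rewrite /= gramE.
- by rewrite det_mx_in_basis.
- apply/colP => i; rewrite !mxE /= hLn.
  by rewrite andbT eq_sym -(coord_free _ _ (basis_free eB)).
Qed.
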